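(* Let $J_1,\ldots,J_K:\mathbb{R}^d\to(0,\infty)$ be differentiable, let $r=[r_1,\ldots,r_K]^\top$ with $r_k>0$ for all $k$, and let $\mu>0$, $\eta>0$. Let $(w_i,p_i)_{i\ge 0}$ be the sequence generated by the EPO-AL algorithm (defined in the context) from some $w_0\in\mathbb{R}^d$ and $p_0=\frac1K\mathbb{1}_K$. Assume that $(w_i,p_i)$ converges, as $i\to\infty$, to a pair $(w_\infty,p_\infty)\in\mathbb{R}^d\times\mathbb{R}^K$ that is a fixed point of the EPO-AL iteration. Then $w_\infty$ is both Pareto stationary and fair with respect to $r$, i.e. $w_\infty\in\mathcal{P}^{\mathrm{st}}\cap\mathcal{F}_r$.
   Context: Notation: $\mathbb{1}_K$ is the all-one vector in $\mathbb{R}^K$; $I_{K\times K}$ is the identity matrix; $\mathrm{diag}(r)$ is the diagonal matrix with the entries of $r$ on its diagonal; $[\cdot]_+=\max\{\cdot,0\}$ is applied element-wise; $\mathcal{J}(w)=[J_1(w),\ldots,J_K(w)]^\top\in\mathbb{R}^K$; $G(w)=[\nabla J_1(w),\ldots,\nabla J_K(w)]\in\mathbb{R}^{d\times K}$; and $$L_r=\mathrm{diag}(r)\Big(I_{K\times K}-\tfrac1K\mathbb{1}_K\mathbb{1}_K^\top\Big)\mathrm{diag}(r).$$ EPO-AL algorithm (Exact Pareto Optimization via Augmented Lagrangian), with step size $\mu>0$ and penalty parameter $\eta>0$: initialize $w_0\in\mathbb{R}^d$ and $p_0=\frac1K\mathbb{1}_K$, and for $i=1,2,\ldots$ set $$w_i=w_{i-1}-\mu\,G(w_{i-1})\big([p_{i-1}]_++\eta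 L_r\mathcal{J}(w_{i-1})\big),\qquad p_i=p_{i-1}+\mu L_r\mathcal{J}(w_{i-1}).$$ A pair $(w_\infty,p_\infty)$ is a fixed point of the iteration if substituting $(w_\infty,p_\infty)$ for both $(w_{i-1},p_{i-1})$ and $(w_i,p_i)$ satisfies both update equations. Simplex: $\Delta^K=\{y\in\mathbb{R}^K: y_k\ge 0\ \forall k,\ y^\top\mathbb{1}_K=1\}$. Pareto stationarity: $\mathcal{P}^{\mathrm{st}}=\{w\in\mathbb{R}^d:\ \min_{p\in\Delta^K}\|G(w)p\|=0\}$, i.e. some convex combination of the gradients $\nabla J_1(w),\ldots,\nabla J_K(w)$ is zero. Fairness: $\mathcal{F}_r=\{w\in\mathbb{R}^d:\ r_1J_1(w)=\cdots=r_KJ_K(w)\}$. *)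

(* Defs.v *)
From HB Require Import structures.
From mathcomp Require Export all_boot all_order all_algebra.
From mathcomp Require Export all_classical all_reals all_analysis.
Export Order.TTheory GRing.Theory Num.Theory.
Export numFieldNormedType.Exports.

Set Implicit Arguments.
Unset Strict Implicit.
Unset Printing Implicit Defensive.

Local Open Scope classical_set_scope.
Local Open Scope ring_scope.

(* The norm `|v| of the library on matrices is the sup norm. *)
Definition eucl_norm (R : realType) (n : nat) (v : 'cV[R]_n) : R :=
  Num.sqrt (\sum_(i < n) v i 0 ^+ 2).

Definition gradient (R : realType) (d : nat) (f : 'cV[R]_d -> R) (w : 'cV[R]_d)
    : 'cV[R]_d :=
  \col_(j < d) 'D_(delta_mx j 0) f w.

Definition simplex (R : realType) (K : nat) : set 'cV[R]_K :=
  [set y : 'cV[R]_K | (forall k, 0 <= y k 0) /\ y^T *m const_mx 1 = 1%:M].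

Definition is_minimum (R : realType) (S : set R) (m : R) : Prop :=
  S m /\ lbound S m.

Definition pos_part (R : realType) (n : nat) (v : 'cV[R]_n) : 'cV[R]_n :=
  map_mx (fun x => Num.max x 0) v.

Section EPO_AL.
Context {R : realType} {d K : nat}.
Implicit Types (J : 'I_K -> 'cV[R]_d -> R) (r : 'cV[R]_K) (mu eta : R).

Definition obj_vec J (w : 'cV[R]_d) : 'cV[R]_K := \col_(k < K) J k w.

Definition grad_mx J (w : 'cV[R]_d) : 'M[R]_(d, K) :=
  \matrix_(j < d, k < K) gradient (J k) w j 0.

Definition fair_mx r : 'M[R]_K :=
  diag_mx r^T
    *m (1%:M - K%:R^-1 *: ((const_mx 1 : 'cV[R]_K) *m (const_mx 1 : 'rV[R]_K)))
    *m diag_mx r^T.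

Definition epo_al_step J r mu eta (x : 'cV[R]_d * 'cV[R]_K)
    : 'cV[R]_d * 'cV[R]_K :=
  let: (w, p) := x in
  (w - mu *: (grad_mx J w *m (pos_part p + eta *: (fair_mx r *m obj_vec J w))),
   p + mu *: (fair_mx r *m obj_vec J w)).

Definition epo_al J r mu eta (w0 : 'cV[R]_d) (i : nat) : 'cV[R]_d * 'cV[R]_K :=
  iter i (epo_al_step J r mu eta) (w0, const_mx K%:R^-1).

Definition pareto_stationary J : set 'cV[R]_d :=
  [set w | is_minimum [set eucl_norm (grad_mx J w *m p) | p in @simplex R K] 0].

Definition fair J r : set 'cV[R]_d :=
  [set w | forall k l, r k 0 * J k w = r l 0 * J l w].

End EPO_AL.

(* Main.v *)
Require Import Defs.

Set Implicit Arguments.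
Unset Strict Implicit.
Unset Printing Implicit Defensive.

(** At a fixed point the multiplier update forces [L_r J = 0], i.e. each
    [r_k J_k] equals the mean of all of them ([fair_mxE]): this is fairness.
    The weight update then reduces to [G [p]_+ = 0], and dividing [[p]_+] by the
    sum of its entries gives a point of the simplex annihilated by [G], provided
    that [[p]_+] is not zero.

    Fixed points alone do not exclude [[p]_+ = 0]; the trajectory does.  The
    vector [(1 / r_k)_k] lies in the left kernel of [L_r], so the weighted sum
    [\sum_k p_k / r_k] is conserved along the iteration ([multiplier_sum_iter]).
    It starts at a positive value, and being continuous in [p] it keeps that
    value in the limit, so some entry of the limit multiplier is positive. *)

Local Open Scope classical_set_scope.
Local Open Scope ring_scope.

(** The middle factor of [L_r] is the projection that subtracts the mean. *)
Lemma fair_mxE (R : realType) (K : nat) (r v : 'cV[R]_K) k :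
  (fair_mx r *m v) k 0 =
    r k 0 * (r k 0 * v k 0 - K%:R^-1 * \sum_l r l 0 * v l 0).
Proof.
rewrite /fair_mx -!mulmxA mul_diag_mx mxE mxE; congr (_ * _).
rewrite mulmxBl mul1mx -scalemxAl -mulmxA mul_diag_mx !mxE big_ord1 !mxE mul1r.
congr (_ - _ * _).
by apply: eq_bigr => l _; rewrite !mxE mul1r.
Qed.

Lemma fair_mx_eq0 (R : realType) (K : nat) (r v : 'cV[R]_K) :
  (forall k, 0 < r k 0) -> fair_mx r *m v = 0 ->
  forall k l, r k 0 * v k 0 = r l 0 * v l 0.
Proof.
move=> r_gt0 Lv0 k l.
have mean j : r j 0 * v j 0 = K%:R^-1 * \sum_i r i 0 * v i 0.
  have /matrixP/(_ j 0)/eqP := Lv0.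
  by rewrite fair_mxE mxE mulf_eq0 gt_eqF //= subr_eq0 => /eqP.
by rewrite !mean.
Qed.

(** Weighting by [1 / r_k] cancels the outer [diag r], and deviations from the
    mean sum to zero. *)
Lemma inv_weights_fair_mx (R : realType) (K : nat) (r v : 'cV[R]_K) :
  (forall k, 0 < r k 0) -> \sum_k (fair_mx r *m v) k 0 / r k 0 = 0.
Proof.
move=> r_gt0; case: K r v r_gt0 => [|K] r v r_gt0; first by rewrite big_ord0.
set s := \sum_l r l 0 * v l 0.
transitivity (\sum_k (r k 0 * v k 0 - K.+1%:R^-1 * s)).
  by apply: eq_bigr => k _; rewrite fair_mxE mulrC mulKf // gt_eqF.
by rewrite sumrB sumr_const card_ord -/s -[X in _ - X]mulr_natl mulVKf ?subrr.
Qed.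

(** Each step moves the multiplier within the range of [L_r], which the weights
    [1 / r_k] annihilate, so the weighted sum never leaves its initial value. *)
Lemma multiplier_sum_iter (R : realType) (d K : nat)
    (J : 'I_K -> 'cV[R]_d -> R) (r : 'cV[R]_K) (mu eta : R) (w0 : 'cV[R]_d) i :
  (forall k, 0 < r k 0) ->
  \sum_k (epo_al J r mu eta w0 i).2 k 0 / r k 0 = \sum_k K%:R^-1 / r k 0.
Proof.
move=> r_gt0; elim: i => [|i IH]; first by apply: eq_bigr => k _; rewrite mxE.
rewrite -IH /epo_al iterS -/(epo_al J r mu eta w0 i).
case: (epo_al _ _ _ _ _ _) => w p /=.
under eq_bigr do rewrite mxE mulrDl.
rewrite big_split /= [X in _ + X](_ : _ = 0) ?addr0 //.
under eq_bigr do rewrite mxE -mulrA.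
by rewrite -mulr_sumr inv_weights_fair_mx ?mulr0.
Qed.

Lemma multiplier_sum_cvg (R : realType) (d K : nat) (r : 'cV[R]_K)
    (x : nat -> 'cV[R]_d * 'cV[R]_K) (w : 'cV[R]_d) (p : 'cV[R]_K) :
  x i @[i --> \oo] --> (w, p) ->
  \sum_k (x i).2 k 0 / r k 0 @[i --> \oo] --> \sum_k p k 0 / r k 0.
Proof.
move=> xwp; have xp : (x i).2 @[i --> \oo] --> p.
  exact: (cvg_comp _ _ xwp cvg_snd).
apply: cvg_big => [|k _]; [exact: add_continuous|apply: cvgMr_tmp].
exact: (cvg_comp _ _ xp (@coord_continuous _ _ _ k 0 p)).
Qed.

(** The conserved sum is positive at the start, hence also at the limit, and a
    sum with positive weights cannot be positive if all entries are
    nonpositive. *)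
Lemma limit_multiplier_gt0 (R : realType) (d K : nat)
    (J : 'I_K -> 'cV[R]_d -> R) (r : 'cV[R]_K) (mu eta : R)
    (w0 winf : 'cV[R]_d) (pinf : 'cV[R]_K) :
  (0 < K)%N -> (forall k, 0 < r k 0) ->
  epo_al J r mu eta w0 i @[i --> \oo] --> (winf, pinf) ->
  exists k, 0 < pinf k 0.
Proof.
move=> K_gt0 r_gt0 /(multiplier_sum_cvg (r := r)).
under eq_fun do rewrite multiplier_sum_iter //.
move=> /(cvg_unique (@norm_hausdorff _ _) (cvg_cst _)) sumE.
have start_gt0 : 0 < \sum_k K%:R^-1 / r k 0.
  rewrite (bigD1 (Ordinal K_gt0)) //= ltr_wpDr ?divr_gt0 ?invr_gt0 ?ltr0n //.
  by rewrite sumr_ge0 // => k _; rewrite divr_ge0 ?invr_ge0 ?ler0n ?ltW.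
apply: contrapT => /forallNP p_le0.
move: start_gt0; rewrite sumE ltNge => /negP; apply.
apply: sumr_le0 => k _; apply: mulr_le0_ge0; last by rewrite invr_ge0 ltW.
by rewrite leNgt; apply/negP/p_le0.
Qed.

Lemma pareto_stationary_ker (R : realType) (d K : nat)
    (J : 'I_K -> 'cV[R]_d -> R) (w : 'cV[R]_d) (q : 'cV[R]_K) k0 :
  (forall k, 0 <= q k 0) -> 0 < q k0 0 -> grad_mx J w *m q = 0 ->
  pareto_stationary J w.
Proof.
move=> q_ge0 qk0 Gq0; set s := \sum_k q k 0.
have s_gt0 : 0 < s by rewrite /s (bigD1 k0) //= ltr_wpDr ?sumr_ge0.
split; last by move=> _ [p _ <-]; exact: sqrtr_ge0.
exists (s^-1 *: q).
  split=> [k|]; first by rewrite mxE mulr_ge0 // invr_ge0 ltW.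
  apply/matrixP => i j; rewrite !ord1 !mxE /=.
  under eq_bigr do rewrite !mxE mulr1.
  by rewrite -mulr_sumr mulVf ?gt_eqF.
rewrite -scalemxAr Gq0 scaler0 /eucl_norm big1 ?sqrtr0 // => i _.
by rewrite mxE expr0n.
Qed.

Theorem theorem1 (R : realType) (d K : nat) (hK : (0 < K)%N)
    (J : 'I_K -> 'cV[R]_d -> R)
    (J_gt0 : forall k w, 0 < J k w)
    (J_diff : forall k w, differentiable (J k) w)
    (r : 'cV[R]_K) (r_gt0 : forall k, 0 < r k 0)
    (mu eta : R) (mu_gt0 : 0 < mu) (eta_gt0 : 0 < eta)
    (w0 winf : 'cV[R]_d) (pinf : 'cV[R]_K)
    (cvg_winf : epo_al J r mu eta w0 i @[i --> \oo] --> (winf, pinf))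
    (fixed_winf : epo_al_step J r mu eta (winf, pinf) = (winf, pinf)) :
  (pareto_stationary J `&` fair J r) winf.
Proof.
have mu_neq0 : mu != 0 by rewrite gt_eqF.
case: fixed_winf => w_fixed p_fixed.
have L0 : fair_mx r *m obj_vec J winf = 0.
  move/eqP: p_fixed; rewrite -subr_eq0 addrAC subrr add0r scaler_eq0.
  by rewrite (negbTE mu_neq0) => /eqP.
have G0 : grad_mx J winf *m pos_part pinf = 0.
  move/eqP: w_fixed; rewrite L0 scaler0 addr0 -subr_eq0 addrAC subrr add0r.
  by rewrite oppr_eq0 scaler_eq0 (negbTE mu_neq0) => /eqP.
split.
  have [k pk_gt0] := limit_multiplier_gt0 hK r_gt0 cvg_winf.
  apply: (pareto_stationary_ker (k0 := k) _ _ G0) => [l|].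
    by rewrite mxE le_max lexx orbT.
  by rewrite mxE lt_max pk_gt0.
by move=> k l; have := fair_mx_eq0 r_gt0 L0 k l; rewrite !mxE.
Qed.
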